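(* Let $n$ be a near-perfect number. Then $n$ is Zumkeller if and only if $\sigma(n)$ is even.
   Context: $\sigma(n)$ denotes the sum of the positive divisors of $n$. A positive integer $n$ is near-perfect if $n$ is the sum of all of its proper divisors except for one of them; equivalently, there is a proper divisor $d$ of $n$ with $\sigma(n)=2n+d$. A positive integer $n$ is Zumkeller if the set of all positive divisors of $n$ can be partitioned into two subsets with the same sum of elements. *)

(* Defs.v *)
From mathcomp Require Import all_boot.

Set Implicit Arguments.
Unset Strict Implicit.
Unset Printing Implicit Defensive.

Definition sigma (n : nat) : nat := \sum_(d <- divisors n) d.

Definition proper_divisor (d n : nat) : bool := (d %| n) && (d < n).

Definition near_perfect (n : nat) : Prop :=
  0 < n /\
  exists d : nat, proper_divisor d n /\
    n = \sum_(e <- divisors n | proper_divisor e n && (e != d)) e.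

(* [divisors n] is duplicate-free, so [perm_eq] says exactly that [A] and [B]
   enumerate two disjoint sets whose union is the set of divisors of [n]. *)
Definition zumkeller (n : nat) : Prop :=
  0 < n /\
  exists A B : seq nat,
    perm_eq (A ++ B) (divisors n) /\ \sum_(d <- A) d = \sum_(d <- B) d.

(* Main.v *)
(** If [sigma n = 2 * n + d] is even then so is [d], hence [d / 2] is again a
    divisor of [n]; it differs from [n], and [{n, d / 2}] has sum
    [n + d / 2 = sigma n / 2]. *)

Require Import Defs.
From mathcomp Require Import all_boot.

(** Two parts of equal sum make [sigma n] even. Conversely, [n] and [d / 2] already account for half
    of [sigma n = 2 * n + d], so all the remaining divisors together form the other half. *)

Lemma near_perfect_sigma (n : nat) : near_perfect n ->
  exists2 d, proper_divisor d n & sigma n = n.*2 + d.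
Proof.
case=> n_gt0 [d [dn eq_n]]; exists d => //; case/andP: (dn) => d_dvd ltdn.
(* Take [n] and the omitted [d] out of the divisor sum; the rest sums to [n] by hypothesis. *)
rewrite /sigma (bigD1_seq n) ?divisors_uniq -?dvdn_divisors //=.
rewrite -big_filter (bigD1_seq d) ?filter_uniq ?divisors_uniq //=; last first.
  by rewrite mem_filter -dvdn_divisors // d_dvd neq_ltn ltdn.
rewrite big_filter_cond -addnn -addnA; congr (n + _); rewrite addnC; congr (_ + d).
(* On divisors of [n > 0], the conditions [e != n] and [e < n] agree. *)
rewrite [RHS]eq_n big_seq_cond [RHS]big_seq_cond; apply: eq_bigl => e.
rewrite -dvdn_divisors // /proper_divisor; case: (boolP (e %| n)) => //= en.
by rewrite [e < n]ltn_neqAle (dvdn_leq n_gt0 en) andbT.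
Qed.

Lemma zumkeller_sigma_even (n : nat) : zumkeller n -> ~~ odd (sigma n).
Proof.
case=> _ [A [B [perm_AB eqAB]]].
by rewrite /sigma -(perm_big _ perm_AB) big_cat /= eqAB addnn odd_double.
Qed.

Theorem proposition7p3 (n : nat) (hn : near_perfect n) :
  zumkeller n <-> ~~ odd (sigma n).
Proof.
split=> [|even_sigma]; first exact: zumkeller_sigma_even.
have n_gt0 : 0 < n by case: hn.
have [d /andP[d_dvd ltdn] sigmaE] := near_perfect_sigma _ hn.
have dE : d./2.*2 = d.
  by rewrite even_halfK //; move: even_sigma; rewrite sigmaE oddD odd_double.
set m := d./2 in dE.
have m_dvd : m %| n by apply: dvdn_trans d_dvd; rewrite -dE -muln2 dvdn_mulr.
have neq_mn : m != n.
  by rewrite neq_ltn (leq_ltn_trans _ ltdn) // -dE -addnn leq_addr.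
set B := rem m (rem n (divisors n)).
have perm_nmB : perm_eq (divisors n) [:: n, m & B].
  apply: perm_trans (perm_to_rem _) _; first by rewrite -dvdn_divisors.
  rewrite perm_cons; apply: perm_to_rem.
  by rewrite mem_rem_uniq ?divisors_uniq // inE neq_mn -dvdn_divisors.
split=> //; exists [:: n; m], B; split; first by rewrite perm_sym.
(* Cancel [n + m] from [n + m + S = 2 * n + 2 * m], where [S] is the sum of [B]. *)
have := sigmaE; rewrite /sigma (perm_big _ perm_nmB) /= !big_cons big_nil.
rewrite addn0 -dE -!addnn -addnA => /addnI.
by rewrite addnCA => /addnI ->.
Qed.
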